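(* Let $R$ be a ring and $M$ a right $R$-module, and consider the following conditions: (1) $M$ is a quasi-duo endoregular module and $M$ is a subdirect product of simple modules. (2) $M$ is an abelian endoregular module and $\operatorname{Rad}(M)=0$. Then (1) implies (2). If $M$ is $M^{(\mathcal I)}$-projective for every index set $\mathcal I$, then the two conditions are equivalent.
   Context: Rings are associative with identity and modules are unitary right modules. A ring $S$ is von Neumann regular if for every $s\in S$ there is $x\in S$ with $sxs=s$; it is abelian if every idempotent of $S$ is central. A module $M$ is endoregular if $\operatorname{End}_R(M)$ is von Neumann regular, and abelian endoregular if $\operatorname{End}_R(M)$ is abelian von Neumann regular. A submodule $N$ of $M$ is fully invariant if $\varphi(N)\subseteq N$ for all $\varphi\in\operatorname{End}_R(M)$; $M$ is quasi-duo if every maximal submodule is fully invariant. $M$ is a subdirect product of a family $\{N_i\}_{i\in\mathcal J}$ if $M$ is (isomorphic to) a submodule of $\prod_{i\in\mathcal J} N_i$ such that every canonical projection restricted to $M$ is surjective. $\operatorname{Rad}(M)$ is the intersection of all maximal submodules of $M$ (equal to $M$ if there are none). $M$ is $L$-projective if for every epimorphism $\pi:L\to N$ and every homomorphism $f:M\to N$ there is $g:M\to L$ with $\pi g=f$. $M^{(\mathcal I)}$ is the direct sum of $|\mathcal I|$ copies of $M$. *)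

(* Defs.v *)
From HB Require Import structures.
From mathcomp Require Import all_boot all_order all_algebra.
From mathcomp Require Import boolp classical_sets functions cardinality.

Set Implicit Arguments.
Unset Strict Implicit.
Unset Printing Implicit Defensive.

Import GRing.Theory.
Local Open Scope ring_scope.
Local Open Scope classical_set_scope.

(* [pzRingType] is used throughout because the zero ring is a ring here (e.g.
   it is the endomorphism ring of the zero module). A right R-module is a left
   module over the converse ring R^c: [a *: x] for [a : R^c] is "x a". *)
Notation rmodType R := (lmodType (R^c)).

Definition von_neumann_regular (S : pzRingType) : Prop :=
  forall s : S, exists x : S, s * x * s = s.

Definition idempotent_elt (S : pzRingType) (e : S) : Prop := e * e = e.

Definition central_elt (S : pzRingType) (e : S) : Prop :=
  forall s : S, e * s = s * e.

Definition abelian_ring (S : pzRingType) : Prop :=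
  forall e : S, idempotent_elt e -> central_elt e.

Definition endring (R : pzRingType) (M : lmodType R) : Type := {linear M -> M}.

Section EndRing.
Variables (R : pzRingType) (M : lmodType R).
Local Notation E := (endring M).

HB.instance Definition _ := gen_eqMixin E.
HB.instance Definition _ := gen_choiceMixin E.

Lemma endring_ext (f g : E) :
  (f : {linear M -> M}) =1 (g : {linear M -> M}) -> f = g.
Proof.
case: f g => [f cf] [g cg] /= /funext efg; subst g.
case: cf cg => [[a] [b]] [[c] [d]].
by rewrite (Prop_irrelevance a c) (Prop_irrelevance b d).
Qed.

Definition end_zero : E := (\0 : {linear M -> M}).
Definition end_one : E := (idfun : {linear M -> M}).
Definition end_opp (f : E) : E :=
  (GRing.opp_fun (f : {linear M -> M}) : {linear M -> M}).
Definition end_add (f g : E) : E :=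
  ((f : {linear M -> M}) \+ (g : {linear M -> M}) : {linear M -> M}).
Definition end_mul (f g : E) : E :=
  ((f : {linear M -> M}) \o (g : {linear M -> M}) : {linear M -> M}).

Lemma end_addA : associative end_add.
Proof. by move=> f g h; apply: endring_ext => x /=; rewrite addrA. Qed.
Lemma end_addC : commutative end_add.
Proof. by move=> f g; apply: endring_ext => x /=; rewrite addrC. Qed.
Lemma end_add0 : left_id end_zero end_add.
Proof. by move=> f; apply: endring_ext => x /=; rewrite add0r. Qed.
Lemma end_addN : left_inverse end_zero end_opp end_add.
Proof. by move=> f; apply: endring_ext => x /=; rewrite addNr. Qed.

HB.instance Definition _ :=
  GRing.isZmodule.Build E end_addA end_addC end_add0 end_addN.

Lemma end_mulA : associative end_mul.
Proof. by move=> f g h; apply: endring_ext. Qed.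
Lemma end_mul1 : left_id end_one end_mul.
Proof. by move=> f; apply: endring_ext. Qed.
Lemma end_mulr1 : right_id end_one end_mul.
Proof. by move=> f; apply: endring_ext. Qed.
Lemma end_mulDl : left_distributive end_mul +%R.
Proof. by move=> f g h; apply: endring_ext. Qed.
Lemma end_mulDr : right_distributive end_mul +%R.
Proof. by move=> f g h; apply: endring_ext => x /=; rewrite raddfD. Qed.

HB.instance Definition _ := GRing.Zmodule_isPzRing.Build E
  end_mulA end_mul1 end_mulr1 end_mulDl end_mulDr.
End EndRing.

Definition endoregular (R : pzRingType) (M : lmodType R) : Prop :=
  von_neumann_regular (endring M).

Definition abelian_endoregular (R : pzRingType) (M : lmodType R) : Prop :=
  abelian_ring (endring M) /\ von_neumann_regular (endring M).

Section Submodules.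
Variables (R : pzRingType) (M : lmodType R).
Implicit Types N K : set M.

Definition submodule N : Prop := submod_closed [in N].

Definition fully_invariant N : Prop :=
  forall phi : {linear M -> M}, phi @` N `<=` N.

Definition maximal_submodule K : Prop :=
  [/\ submodule K, K <> setT
    & forall N, submodule N -> K `<=` N -> N = K \/ N = setT].

Definition quasi_duo : Prop :=
  forall K, maximal_submodule K -> fully_invariant K.

(* The intersection of the empty family is [setT], i.e. the whole of M. *)
Definition Rad : set M := \bigcap_(K in maximal_submodule) K.

Definition simple_module : Prop :=
  (exists x : M, x != 0) /\
  forall N, submodule N -> N = [set 0] \/ N = setT.
End Submodules.

Arguments quasi_duo {R} M.
Arguments Rad {R} M.
Arguments simple_module {R} M.

Definition mod_prod (R : pzRingType) (I : Type) (N : I -> lmodType R) : Type :=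
  forall i, N i.

Section ModProd.
Variables (R : pzRingType) (I : Type) (N : I -> lmodType R).
Local Notation P := (mod_prod N).

HB.instance Definition _ := gen_eqMixin P.
HB.instance Definition _ := gen_choiceMixin P.

Definition prod_zero : P := fun i => 0.
Definition prod_opp (f : P) : P := fun i => - f i.
Definition prod_add (f g : P) : P := fun i => f i + g i.
Definition prod_scale (a : R) (f : P) : P := fun i => a *: f i.

Lemma prod_addA : associative prod_add.
Proof. by move=> f g h; apply: functional_extensionality_dep => i; apply: addrA. Qed.
Lemma prod_addC : commutative prod_add.
Proof. by move=> f g; apply: functional_extensionality_dep => i; apply: addrC. Qed.
Lemma prod_add0 : left_id prod_zero prod_add.
Proof. by move=> f; apply: functional_extensionality_dep => i; apply: add0r. Qed.
Lemma prod_addN : left_inverse prod_zero prod_opp prod_add.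
Proof. by move=> f; apply: functional_extensionality_dep => i; apply: addNr. Qed.

HB.instance Definition _ :=
  GRing.isZmodule.Build P prod_addA prod_addC prod_add0 prod_addN.

Lemma prod_scaleA a b f : prod_scale a (prod_scale b f) = prod_scale (a * b) f.
Proof. by apply: functional_extensionality_dep => i; apply: scalerA. Qed.
Lemma prod_scale1 : left_id 1 prod_scale.
Proof. by move=> f; apply: functional_extensionality_dep => i; apply: scale1r. Qed.
Lemma prod_scaleDr : right_distributive prod_scale +%R.
Proof. by move=> a f g; apply: functional_extensionality_dep => i; apply: scalerDr. Qed.
Lemma prod_scaleDl f : {morph prod_scale^~ f : a b / a + b}.
Proof. by move=> a b; apply: functional_extensionality_dep => i; apply: scalerDl. Qed.

HB.instance Definition _ := GRing.Zmodule_isLmodule.Build R P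
  prod_scaleA prod_scale1 prod_scaleDr prod_scaleDl.

Definition prod_proj (i : I) (f : P) : N i := f i.
End ModProd.

Definition subdirect_product (R : pzRingType) (M : lmodType R)
    (I : Type) (N : I -> lmodType R) : Prop :=
  exists2 f : {linear M -> mod_prod N}, injective f
    & forall (i : I) (y : N i), exists x : M, prod_proj i (f x) = y.

Definition subdirect_product_of_simples
    (R : pzRingType) (M : lmodType R) : Prop :=
  exists (I : Type) (N : I -> lmodType R),
    (forall i, simple_module (N i)) /\ subdirect_product M N.

(* M^(I): the submodule of finitely supported families in the product. *)
Section DirectSum.
Variables (R : pzRingType) (I : Type) (M : lmodType R).
Local Notation P := (mod_prod (fun _ : I => M)).

Definition finsupp_family : {pred P} :=
  fun f : P => `[< finite_set [set i | prod_proj i f != 0] >].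

Lemma finsupp_family_closed : submod_closed finsupp_family.
Proof.
split=> [|a f g /asboolP ff /asboolP fg]; apply/asboolP.
  by rewrite (_ : [set _ | _] = set0) //; apply/seteqP; split=> i //=;
     rewrite /prod_proj eqxx.
apply: (@sub_finite_set _ _
  ([set i | prod_proj i f != 0] `|` [set i | prod_proj i g != 0])).
  move=> i /= fgi; case: (eqVneq (prod_proj i f) 0) => fi; last by left.
  case: (eqVneq (prod_proj i g) 0) => gi; last by right.
  move: fgi; rewrite (_ : prod_proj i _ = a *: prod_proj i f + prod_proj i g) //.
  by rewrite fi gi scaler0 addr0 eqxx.
by rewrite finite_setU.
Qed.

HB.instance Definition _ :=
  GRing.isSubmodClosed.Build R P finsupp_family finsupp_family_closed.

Record mod_copower : Type :=
  ModCopower { copower_val :> P; _ : copower_val \in finsupp_family }.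

HB.instance Definition _ := [isSub for copower_val].
HB.instance Definition _ := [Choice of mod_copower by <:].
HB.instance Definition _ := [SubChoice_isSubLmodule of mod_copower by <:].
End DirectSum.

Definition relatively_projective (R : pzRingType) (M L : lmodType R) : Prop :=
  forall (N : lmodType R) (p : {linear L -> N}) (f : {linear M -> N}),
    (forall y : N, exists x : L, p x = y) ->
    exists g : {linear M -> L}, forall x : M, p (g x) = f x.

(* Main.v *)
Require Import Defs.
From HB Require Import structures.
From mathcomp Require Import all_boot all_algebra.
From mathcomp Require Import boolp classical_sets cardinality.

Set Implicit Arguments.
Unset Strict Implicit.
Unset Printing Implicit Defensive.

Import GRing.Theory Quotient.
Local Open Scope ring_scope.
Local Open Scope classical_set_scope.
Local Open Scope quotient_scope.

(** (1) => (2): the kernels of the projections onto the simple factors are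
    maximal submodules with zero intersection. If K is maximal and fully
    invariant, an idempotent endomorphism e induces 0 or 1 on the simple module
    M/K, so e s (1 - e) maps M into K for every endomorphism s; as the maximal
    submodules meet in 0, e s (1 - e) = 0, whence e is central.

    (2) => (1): let K be maximal with projection p : M -> M/K, and suppose
    s K is not contained in K. Then s K + K = M, so (p, p s) : M -> (M/K)^2 is
    onto, and self-projectivity lifts (p, 0) to some endomorphism g, that is,
    (1 - g) M and s g M lie in K. Since End(M) is abelian regular, the right
    ideal of the f with f M in K is two-sided, so s (1 - g) also maps M into K.
    Hence so does s, a contradiction. *)

(** * Submodules as sets *)

Section Submodule.
Variables (R : pzRingType) (M : lmodType R).
Implicit Types (K : set M) (x y : M).

Lemma submoduleP K :
  submodule K <-> K 0 /\ forall a x y, K x -> K y -> K (a *: x + y).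
Proof.
split=> [[K0 KZD]|[K0 KZD]].
  split=> [|a x y Kx Ky]; first exact: set_mem K0.
  by apply/set_mem/KZD; apply/mem_set.
split=> [|a x y /set_mem Kx /set_mem Ky]; apply/mem_set => //.
exact: KZD.
Qed.

Lemma submodule0 K : submodule K -> K 0.
Proof. by case/submoduleP. Qed.

Lemma submoduleD K x y : submodule K -> K x -> K y -> K (x + y).
Proof. by move=> /submoduleP[_ KZD] Kx Ky; rewrite -[x]scale1r; apply: KZD. Qed.

Lemma submoduleZ K a x : submodule K -> K x -> K (a *: x).
Proof.
by move=> /submoduleP[K0 KZD] Kx; rewrite -[_ *: _]addr0; apply: KZD.
Qed.

Lemma submoduleB K x y : submodule K -> K x -> K y -> K (x - y).
Proof.
move=> sK Kx Ky; apply: submoduleD => //.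
by rewrite -scaleN1r; apply: submoduleZ.
Qed.

Lemma submodule_set0 : submodule [set 0 : M].
Proof.
by apply/submoduleP; split=> // a x y /= -> ->; rewrite scaler0 addr0.
Qed.
End Submodule.

Lemma submodule_preimage (R : pzRingType) (M N : lmodType R)
    (f : {linear M -> N}) (K : set N) :
  submodule K -> submodule (f @^-1` K).
Proof.
move=> sK; apply/submoduleP; split=> [|a x y /= Kx Ky].
  by rewrite /= linear0; exact: (submodule0 sK).
by rewrite linearP; apply: submoduleD => //; apply: submoduleZ.
Qed.

(** * The quotient of a module by a submodule *)

Section QuotientModule.
Variables (R : pzRingType) (M : lmodType R) (K : set M) (sK : submodule K).

(** The proof is taken as an argument so that the closedness instance, and with it the additive
    quotient, can be attached to this predicate. *)
Definition submodule_pred of submodule K : {pred M} := [in K].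

HB.instance Definition _ :=
  GRing.isSubmodClosed.Build R M (submodule_pred sK)
    (sK : GRing.submod_closed (submodule_pred sK)).

Definition mod_quot : Type := {quot (submodule_pred sK)}.

HB.instance Definition _ := GRing.Zmodule.on mod_quot.

Definition mod_proj (x : M) : mod_quot := \pi_({quot (submodule_pred sK)}) x.

Lemma mod_proj_surj (q : mod_quot) : exists x, mod_proj x = q.
Proof. by exists (repr q); apply: reprK. Qed.

Lemma mod_proj_eq x y : mod_proj x = mod_proj y <-> K (x - y).
Proof.
split=> [/eqP|Kxy].
  by rewrite /mod_proj -idealrBE => /set_mem.
by apply/eqP; rewrite /mod_proj -idealrBE; apply/mem_set.
Qed.

Lemma mod_proj_is_zmod_morphism : zmod_morphism mod_proj.
Proof. exact: (raddfB (\pi_({quot (submodule_pred sK)}))). Qed.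

Lemma mod_projD : {morph mod_proj : x y / x + y}.
Proof. exact: (raddfD (\pi_({quot (submodule_pred sK)}))). Qed.

Definition quot_scale (a : R) (q : mod_quot) : mod_quot :=
  mod_proj (a *: (repr q : M)).

(** The action does not depend on the representative chosen in [quot_scale]; the module axioms then
    descend from [M] along the surjection [mod_proj]. *)
Lemma mod_projZ a x : mod_proj (a *: x) = quot_scale a (mod_proj x).
Proof.
apply/mod_proj_eq; rewrite -scalerBr; apply: submoduleZ => //.
by apply/mod_proj_eq; rewrite [RHS]reprK.
Qed.

Lemma quot_scaleA a b q : quot_scale a (quot_scale b q) = quot_scale (a * b) q.
Proof. by have [x <-] := mod_proj_surj q; rewrite -!mod_projZ scalerA. Qed.

Lemma quot_scale1 : left_id 1 quot_scale.
Proof.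
by move=> q; have [x <-] := mod_proj_surj q; rewrite -mod_projZ scale1r.
Qed.

Lemma quot_scaleDr : right_distributive quot_scale +%R.
Proof.
move=> a q r; have [x <-] := mod_proj_surj q; have [y <-] := mod_proj_surj r.
by rewrite -mod_projD -!mod_projZ -mod_projD scalerDr.
Qed.

Lemma quot_scaleDl q : {morph quot_scale^~ q : a b / a + b}.
Proof.
move=> a b; have [x <-] := mod_proj_surj q.
by rewrite -!mod_projZ -mod_projD scalerDl.
Qed.

HB.instance Definition _ := GRing.Zmodule_isLmodule.Build R mod_quot
  quot_scaleA quot_scale1 quot_scaleDr quot_scaleDl.

HB.instance Definition _ :=
  GRing.isZmodMorphism.Build M mod_quot mod_proj mod_proj_is_zmod_morphism.
HB.instance Definition _ :=
  GRing.isScalable.Build R M mod_quot *:%R mod_proj mod_projZ.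

Lemma mod_proj_eq0 x : mod_proj x = 0 <-> K x.
Proof. by rewrite -[in K x](subr0 x) -mod_proj_eq linear0. Qed.
End QuotientModule.

(** * Maximal submodules, simple quotients and the radical *)

Section MaximalSubmodule.
Variables (R : pzRingType) (M : lmodType R).
Implicit Types K : set M.

Lemma simple_mod_quot K (mK : maximal_submodule K) (sK : submodule K) :
  simple_module (mod_quot sK).
Proof.
have [_ KnT Kmax] := mK; split.
  case: (pselect (exists x, ~ K x)) => [[x nKx]|KT].
    exists (mod_proj sK x); apply/eqP => /mod_proj_eq0 Kx; exact: nKx.
  case: KnT; apply/seteqP; split=> // x _.
  by apply: contrapT => nKx; apply: KT; exists x.
move=> N sN; have [||NK|NT] := Kmax (mod_proj sK @^-1` N).
- exact: submodule_preimage.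
- by move=> x Kx; rewrite /= (mod_proj_eq0 sK x).2 //; apply: submodule0.
- left; apply/seteqP; split=> [q Nq|q ->]; last exact: submodule0.
  have [x qx] := mod_proj_surj q; rewrite -qx in Nq *; apply/mod_proj_eq0.
  by rewrite -NK.
- right; apply/seteqP; split=> // q _; have [x <-] := mod_proj_surj q.
  by rewrite -[N _]/((mod_proj sK @^-1` N) x) NT.
Qed.

(** If L contains the kernel, then f(L) is 0 or [N]. In the first case L is the kernel; in the
    second every x differs from an element of L by an element of the kernel, so L is everything. *)
Lemma maximal_kernel (N : lmodType R) (f : {linear M -> N}) :
  simple_module N -> (forall y, exists x, f x = y) ->
  maximal_submodule (f @^-1` [set 0]).
Proof.
move=> [[y0 /eqP y0_neq0] Nsimple] fsurj; split.
- exact/submodule_preimage/submodule_set0.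
- move=> kerT; have [x fx] := fsurj y0; apply: y0_neq0; rewrite -fx.
  by rewrite -[_ = 0]/((f @^-1` [set 0]) x) kerT.
- move=> L sL kerL; have [|im0|imT] := Nsimple (f @` L).
  + apply/submoduleP; split.
      by exists 0; rewrite ?linear0 //; apply: submodule0.
    move=> a _ _ [x Lx <-] [y Ly <-]; exists (a *: x + y); last exact: linearP.
    by apply: submoduleD => //; apply: submoduleZ.
  + left; apply/seteqP; split=> // x Lx.
    by rewrite -[_ x]/([set 0] (f x)) -im0; exists x.
  + right; apply/seteqP; split=> // x _.
    have [y Ly fyx] : (f @` L) (f x) by rewrite imT.
    rewrite -(subrK y x); apply: submoduleD => //; apply: kerL => /=.
    by rewrite linearB fyx subrr.
Qed.

Lemma subdirect_product_Rad0 :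
  subdirect_product_of_simples M -> Rad M = [set 0].
Proof.
move=> [I [N [Nsimple [f finj fsurj]]]]; apply/seteqP; split=> [x Rx|_ ->].
  apply: finj; rewrite linear0; apply: functional_extensionality_dep => i.
  have proj_linear : linear (fun x => prod_proj i (f x)).
    by move=> a u v; rewrite linearP.
  pose fi : {linear M -> N i} := HB.pack (fun x => prod_proj i (f x))
    (GRing.isLinear.Build _ _ _ _ _ proj_linear).
  exact: (Rx _ (maximal_kernel (f := fi) (Nsimple i) (fsurj i))).
by move=> K [sK _ _]; apply: submodule0.
Qed.

(** The factors are the quotients by all maximal submodules; the kernel of the map into their
    product is the radical. *)
Lemma Rad0_subdirect_product :
  Rad M = [set 0] -> subdirect_product_of_simples M.
Proof.
move=> Rad0; pose I := {K : set M | maximal_submodule K}.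
have sub_of (i : I) : submodule (sval i) by case: i => K [].
pose N (i : I) : lmodType R := mod_quot (sub_of i).
exists I, N; split=> [i|]; first exact/simple_mod_quot/(svalP i).
pose f (x : M) : mod_prod N := fun i => mod_proj (sub_of i) x.
have f_linear : linear f.
  by move=> a u v; apply: functional_extensionality_dep => i; apply: linearP.
pose fl : {linear M -> mod_prod N} :=
  HB.pack f (GRing.isLinear.Build _ _ _ _ f f_linear).
exists fl => [x y /= fxy|i q].
  apply/eqP; rewrite -subr_eq0; apply/eqP.
  rewrite -[_ = 0]/([set 0] (x - y)) -Rad0 => K mK.
  by apply/(mod_proj_eq (sub_of (exist _ K mK))); apply: (congr1 (@^~ _) fxy).
exact: mod_proj_surj.
Qed.
End MaximalSubmodule.

(** * Endomorphisms and maximal submodules *)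

Section Endomorphisms.
Variables (R : pzRingType) (M : lmodType R).
Implicit Types (K : set M) (e f s g : {linear M -> M}).

(** By invariance the preimage of [K] under e contains [K], so it is [K] or [M]. It always contains
    x - e x, which e kills. *)
Lemma idempotent_mod_maximal K e :
  maximal_submodule K -> fully_invariant K -> (forall x, e (e x) = e x) ->
  (forall x, K (e x)) \/ (forall x, K (x - e x)).
Proof.
move=> [sK _ Kmax] Kinv ee; have [||eK|eT] := Kmax (e @^-1` K).
- exact: submodule_preimage.
- by move=> x Kx; apply: Kinv; exists x.
- right=> x; rewrite -eK /= linearB /= ee subrr; exact: submodule0.
- by left=> x; rewrite -[K _]/((e @^-1` K) x) eT.
Qed.

Lemma quasi_duo_idempotent_corner e s :
  quasi_duo M -> Rad M = [set 0] -> (forall x, e (e x) = e x) ->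
  forall x, e (s (x - e x)) = 0.
Proof.
move=> qd Rad0 ee x; rewrite -[_ = 0]/([set 0] _) -Rad0 => K mK.
have Kinv := qd _ mK.
have Kim (h : {linear M -> M}) y : K y -> K (h y).
  by move=> Ky; apply: (Kinv h); exists y.
have [Ke|Ke] := idempotent_mod_maximal mK Kinv ee; first exact: Ke.
(* Here x - e x lies in [K], which s and then e preserve. *)
exact/Kim/Kim.
Qed.

Lemma quasi_duo_abelian :
  quasi_duo M -> Rad M = [set 0] -> abelian_ring (endring M).
Proof.
move=> qd Rad0 e ide s.
pose e0 : {linear M -> M} := e; pose s0 : {linear M -> M} := s.
have ee x : e0 (e0 x) = e0 x by rewrite -[RHS]/((e : {linear M -> M}) x) -ide.
pose e1 : {linear M -> M} := (1 - e : endring M).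
have e1E x : e1 x = x - e0 x by [].
have ee1 x : e1 (e1 x) = e1 x by rewrite !e1E linearB /= ee subrr subr0.
apply: endring_ext => x; rewrite -[LHS]/(e0 (s0 x)) -[RHS]/(s0 (e0 x)).
(* The corner e s (1 - e) = 0 gives e s = e s e. *)
have /eqP := quasi_duo_idempotent_corner s0 qd Rad0 ee x.
rewrite linearB linearB subr_eq0 => /eqP ->.
(* The opposite corner (1 - e) s e = 0 gives s e = e s e. *)
have := quasi_duo_idempotent_corner s0 qd Rad0 ee1 x.
have -> : x - e1 x = e0 x by rewrite e1E opprB addrC subrK.
by rewrite e1E => /eqP; rewrite subr_eq0 => /eqP <-.
Qed.

(** With f = f g f, the idempotent f g is central, so s f = s (f g) f = f (g s f) takes its values
    in the image of f. *)
Lemma abelian_regular_image K (f s : endring M) :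
  abelian_endoregular M ->
  (forall x, K ((f : {linear M -> M}) x)) ->
  forall x, K ((s : {linear M -> M}) ((f : {linear M -> M}) x)).
Proof.
move=> [ab reg] Kf x; have [g fgf] := reg f.
have fgC : f * g * s = s * (f * g).
  by apply: ab; rewrite /idempotent_elt mulrA fgf.
have -> : (s : {linear M -> M}) ((f : {linear M -> M}) x) =
          (s * f : endring M) x by [].
by rewrite -[in s * f]fgf mulrA -fgC -!mulrA; apply: Kf.
Qed.

(** A copower over a one-point index set is a copy of [M], with evaluation at [tt] as the
    identification. *)
Lemma self_projective_lift (N : lmodType R) (p f : {linear M -> N}) :
  relatively_projective M (mod_copower unit M) ->
  (forall y, exists x, p x = y) ->
  exists g : {linear M -> M}, forall x, p (g x) = f x.
Proof.
move=> proj psurj; pose ev (u : mod_copower unit M) : M := copower_val u tt.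
have ev_linear : linear ev by [].
pose evl : {linear mod_copower unit M -> M} :=
  HB.pack ev (GRing.isLinear.Build _ _ _ _ ev ev_linear).
have [|g pg] := proj N (p \o evl) f.
  move=> y; have [x <-] := psurj y.
  have xfin : ((fun=> x) : mod_prod (fun _ : unit => M))
      \in @finsupp_family R unit M.
    by apply/asboolP; apply: finite_finset.
  by exists (ModCopower xfin).
by exists (evl \o g).
Qed.

Lemma abelian_endoregular_quasi_duo :
  relatively_projective M (mod_copower unit M) ->
  abelian_endoregular M -> quasi_duo M.
Proof.
move=> proj ab K [sK KnT Kmax] s _ [k Kk <-].
(* This is s K + K. *)
pose L := [set y | exists2 z, K z & K (y - s z)].
have sL : submodule L.
  apply/submoduleP; split=> [|a x y [u Ku Kxu] [v Kv Kyv]].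
    by exists 0; rewrite ?linear0 ?addr0; apply: (submodule0 sK).
  exists (a *: u + v); first by apply: (submoduleD sK) => //; apply: submoduleZ.
  rewrite linearP opprD addrACA -scalerBr.
  by apply: (submoduleD sK) => //; apply: submoduleZ.
have KL : K `<=` L.
  by move=> x Kx; exists 0; rewrite ?linear0 ?addr0 //; apply: (submodule0 sK).
have [LK|LT] := Kmax _ sL KL.
  by rewrite -LK; exists k; rewrite // subrr; apply: (submodule0 sK).
pose Q : lmodType R := (mod_quot sK * mod_quot sK)%type.
pose pair_with (h : {linear M -> M}) (x : M) : Q :=
  (mod_proj sK x, mod_proj sK (h x)).
have pair_linear h : linear (pair_with h).
  by move=> a x y; rewrite /pair_with !linearP.
pose p : {linear M -> Q} :=
  HB.pack (pair_with s) (GRing.isLinear.Build _ _ _ _ _ (pair_linear s)).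
pose q : {linear M -> Q} :=
  HB.pack (pair_with \0) (GRing.isLinear.Build _ _ _ _ _ (pair_linear \0)).
have psurj y : exists x, p x = y.
  case: y => y1 y2; have [a <-] := mod_proj_surj y1.
  have [b <-] := mod_proj_surj y2.
  have [z Kz Kbz] : L (b - s a) by rewrite LT.
  (* Adding z from [K] leaves the first coordinate alone and moves s a to b modulo [K]. *)
  exists (a + z); congr pair; apply/mod_proj_eq; first by rewrite addrC addKr.
  rewrite linearD -opprB -[X in K X]add0r; apply: (submoduleB sK) => //.
    exact: (submodule0 sK).
  by rewrite opprD addrA.
have [g pg] := self_projective_lift q proj psurj.
have Kg x : K (x - g x) by have [/esym/mod_proj_eq] := pg x.
have Ksg x : K (s (g x)).
  by have [_] := pg x; rewrite linear0 => /mod_proj_eq0.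
have Ks1g := @abelian_regular_image K (1 - (g : endring M)) s ab Kg.
(* Split k = (k - g k) + g k: s sends both summands into [K]. *)
rewrite -(subrK (g k) k) linearD; apply: (submoduleD sK) => //.
exact: Ks1g.
Qed.
End Endomorphisms.

Theorem theorem3p6 (R : pzRingType) (M : rmodType R) :
  let cond1 :=
    quasi_duo M /\ endoregular M /\ subdirect_product_of_simples M in
  let cond2 := abelian_endoregular M /\ Rad M = [set 0%R]%classic in
  (cond1 -> cond2) /\
  ((forall I : Type, relatively_projective M (mod_copower I M)) ->
   (cond1 <-> cond2)).
Proof.
move=> cond1 cond2.
have cond12 : cond1 -> cond2.
  move=> [qd [reg /subdirect_product_Rad0 Rad0]].
  by split=> //; split=> //; apply: quasi_duo_abelian.
split=> // proj; split=> // -[ab Rad0].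
split; first exact: abelian_endoregular_quasi_duo (proj unit) ab.
by split; [case: ab | apply: Rad0_subdirect_product].
Qed.
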